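(* Let $m\ge n\ge 2$ be integers and let $$r=\min\left\{n,\left\lfloor\frac{m+n}{3}\right\rfloor+1\right\}-1.$$ Then there exists a bipartite graph $G_0=(X,Y;E)$ with $|X|=m$, $|Y|=n$ and minimum degree $\delta(G_0)=r$, containing an edge $xy$ of non-positive Lin--Lu--Yau curvature, i.e. with $\kappa_{\mathrm{LLY}}(x,y)\le 0$.
   Context: All graphs are finite and simple. Let $\rho$ denote graph distance and $d_x$ the degree of a vertex $x$. For probability measures $\mu_1,\mu_2$ on $V(G)$, the $L^1$-Wasserstein distance is $W(\mu_1,\mu_2)=\inf_\pi\sum_{u,v\in V}\rho(u,v)\pi(u,v)$, the infimum over $\pi:V\times V\to[0,1]$ with $\sum_v\pi(u,v)=\mu_1(u)$ for all $u$ and $\sum_u\pi(u,v)=\mu_2(v)$ for all $v$. For $\alpha\in[0,1]$ and a vertex $x$, $\mu_x^\alpha$ is the measure with $\mu_x^\alpha(x)=\alpha$, $\mu_x^\alpha(z)=\frac{1-\alpha}{d_x}$ if $z$ is adjacent to $x$, and $0$ otherwise. For an edge $xy$ (so $\rho(x,y)=1$), $\kappa_\alpha(x,y)=1-W(\mu_x^\alpha,\mu_y^\alpha)$ and the Lin--Lu--Yau curvature is $\kappa_{\mathrm{LLY}}(x,y)=\lim_{\alpha\to1^-}\frac{\kappa_\alpha(x,y)}{1-\alpha}$. (For edges, all the measures involved are supported in one connected component.) *)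

(* Defs.v *)
From HB Require Import structures.
From mathcomp Require Import all_boot all_order all_algebra.
From mathcomp Require Import all_classical all_reals all_analysis.
Import Order.TTheory GRing.Theory Num.Theory.
Import numFieldNormedType.Exports.

Set Implicit Arguments.
Unset Strict Implicit.
Unset Printing Implicit Defensive.

Local Open Scope ring_scope.

Record sgraph := SGraph {
  vertex :> finType;
  adj : rel vertex;
  adj_sym : symmetric adj;
  adj_irr : irreflexive adj
}.

Section Graph.
Variable G : sgraph.

Definition deg (x : G) : nat := #|[set y | adj x y]%SET|.

(* The default value #|G| exceeds every degree, so it only matters when G has
   no vertex. *)
Definition min_degree : nat := \big[minn/#|G|]_(x : G) deg x.

Definition bipartition (X Y : {set G}) : Prop :=
  [/\ (X :|: Y = [set: G])%SET, [disjoint X & Y],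
      {in X &, forall u v, ~~ adj u v} & {in Y &, forall u v, ~~ adj u v}].

Definition walk_of_length (k : nat) (x y : G) : bool :=
  [exists p : k.-tuple G, path (@adj G) x p && (last x p == y)].

(* Graph distance: the least k < #|G| such that a walk of length k joins x to y;
   the value is #|G| when x and y lie in different components. *)
Definition dist (x y : G) : nat :=
  find (fun k => walk_of_length k x y) (iota 0 #|G|).

End Graph.

Section Curvature.
Local Open Scope classical_set_scope.
Variables (R : realType) (G : sgraph).
Implicit Types (mu : G -> R) (x y : G) (a : R).

Definition coupling mu1 mu2 (pi : G -> G -> R) : Prop :=
  [/\ forall u v, 0 <= pi u v <= 1,
      forall u, \sum_v pi u v = mu1 u
    & forall v, \sum_u pi u v = mu2 v].

Definition transport_cost (pi : G -> G -> R) : R :=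
  \sum_u \sum_v (dist u v)%:R * pi u v.

Definition wasserstein mu1 mu2 : R :=
  inf [set transport_cost pi | pi in coupling mu1 mu2].

Definition lazy_measure a x : G -> R := fun z =>
  if z == x then a else if adj x z then (1 - a) / (deg x)%:R else 0.

Definition kappa a x y : R :=
  1 - wasserstein (lazy_measure a x) (lazy_measure a y).

Definition kappa_quotient x y : R -> R := fun a => kappa a x y / (1 - a).

(* lim is a total operator: kappa_LLY x y is meaningful only together with
   cvg (kappa_quotient x y a @[a --> (1 : R)^'-]). *)
Definition kappa_LLY x y : R := lim (kappa_quotient x y a @[a --> (1 : R)^'-]).

End Curvature.

(* Main.v *)
(* The edge xy is chosen with d(x) = d(y) = d and a set A of k neighbours of x,
   other than y, which among the neighbours of y other than x are joined only to
   a set B of k - 1 vertices. The remaining d - k neighbours C of y are not joined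
   to A, so one unit of mass has to travel a distance 3. All pairs not excluded by
   these constraints are joined. The degree condition amounts to r <= n - k and
   r <= m - (d - k); with d = max(r, 2), the choice k = min(n - r, d - 1) works
   because 3 r <= m + n. For a in [1/2, 1], an explicit
   plan and a 1-Lipschitz potential show that the Wasserstein distance is exactly
   1, so the curvature is 0. *)
Require Import Defs.
From HB Require Import structures.
From mathcomp Require Import all_boot all_order all_algebra.
From mathcomp Require Import all_classical all_reals all_analysis.
From mathcomp Require Import zify ring lra.
Import Order.TTheory GRing.Theory Num.Theory.
Import numFieldNormedType.Exports.

Set Implicit Arguments.
Unset Strict Implicit.
Unset Printing Implicit Defensive.

Local Open Scope classical_set_scope.
Local Open Scope ring_scope.

(** * Minimum degree, graph distance and transport duality *)

Lemma min_degree_eq (G : sgraph) (r : nat) (z : G) :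
  (forall u : G, (r <= deg u)%N) -> deg z = r -> min_degree G = r.
Proof.
move=> rdeg degz; apply/eqP; rewrite eqn_leq; apply/andP; split.
  rewrite /min_degree.
  elim: (index_enum G) (mem_index_enum z) => // u s IHs.
  rewrite big_cons inE geq_min => /predU1P[<-|/IHs ->]; last by rewrite orbT.
  by rewrite degz leqnn.
rewrite /min_degree; elim/big_ind: _ => // [|p q rp rq].
  by rewrite -degz max_card.
by rewrite leq_min rp.
Qed.

Lemma dist_le_walk (G : sgraph) (u v : G) (p : seq G) :
  path (@adj G) u p -> last u p = v -> (dist u v <= size p)%N.
Proof.
move=> up lastp; rewrite leqNgt; apply/negP => lt_p.
have := before_find 0%N lt_p.
(* [find] never exceeds the length [#|G|] of the searched range, so a walk shorter than the distance
   has its length in that range. *)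
have p_lt : (size p < #|G|)%N.
  by rewrite (leq_trans lt_p)// -[leqRHS](size_iota 0) find_size.
rewrite nth_iota// add0n => /negbT/negP; apply.
rewrite /walk_of_length; apply/existsP; exists (in_tuple p).
by rewrite /= up lastp eqxx.
Qed.

(** The edge bound telescopes along a shortest walk. The global bound covers vertices in different
    components, where [dist] is [#|G|]. *)
Lemma lipschitz_dist (R : realType) (G : sgraph) (f : G -> R) :
    (forall u v : G, adj u v -> f u - f v <= 1) ->
    (forall u v : G, f u - f v <= #|G|%:R) ->
  forall u v : G, f u - f v <= (dist u v)%:R.
Proof.
move=> f_adj f_osc u v; rewrite /dist.
have [|] := boolP (has (fun k => walk_of_length k u v) (iota 0 #|G|)); last first.
  by move/hasNfind ->; rewrite size_iota.
move=> walk; have := nth_find 0%N walk.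
rewrite nth_iota; last by rewrite -[X in (_ < X)%N](size_iota 0) -has_find.
rewrite add0n; set k := find _ _.
case/existsP => -[p /= /eqP <-] /andP[up /eqP <-].
elim: p u up {walk k} => [|w s IHs] u /=; first by rewrite subrr.
by case/andP => /f_adj uw /IHs; rewrite -natr1; lra.
Qed.

(* Kantorovich duality with complementary slackness: [pi] and [f] certify each
   other's optimality. *)
Lemma wasserstein_certificate (R : realType) (G : sgraph) (mu1 mu2 f : G -> R)
    (pi : G -> G -> R) :
    coupling mu1 mu2 pi ->
    (forall u v, f u - f v <= (dist u v)%:R) ->
    (forall u v, pi u v != 0 -> (dist u v)%:R <= f u - f v) ->
  wasserstein mu1 mu2 = \sum_u f u * mu1 u - \sum_v f v * mu2 v.
Proof.
move=> cpi f_lip f_tight.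
(* The marginal conditions turn the dual value into the integral of [f u - f v] against any
   coupling. *)
have dual rho : coupling mu1 mu2 rho ->
    \sum_u f u * mu1 u - \sum_v f v * mu2 v
    = \sum_u \sum_v (f u - f v) * rho u v.
  case=> _ rho1 rho2.
  under eq_bigr do rewrite -rho1 mulr_sumr.
  under [X in _ - X]eq_bigr do rewrite -rho2 mulr_sumr.
  rewrite [X in _ - X]exchange_big -sumrB; apply: eq_bigr => u _.
  by rewrite -sumrB; apply: eq_bigr => v _; rewrite mulrBl.
have lb rho : coupling mu1 mu2 rho ->
    \sum_u f u * mu1 u - \sum_v f v * mu2 v <= transport_cost rho.
  move=> crho; rewrite (dual _ crho).
  apply: ler_sum => u _; apply: ler_sum => v _.
  by case: crho => rho_ge0 _ _; rewrite ler_wpM2r//; case/andP: (rho_ge0 u v).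
have lbs : lbound [set transport_cost rho | rho in coupling mu1 mu2]
    (\sum_u f u * mu1 u - \sum_v f v * mu2 v).
  by move=> _ [rho crho <-]; exact: lb.
have pi_in : [set transport_cost rho | rho in coupling mu1 mu2]
    (transport_cost pi) by exists pi.
apply/eqP; rewrite eq_le; apply/andP; split; last first.
  by apply: lb_le_inf => //; exists (transport_cost pi).
apply: (@le_trans _ _ (transport_cost pi)).
  by apply: ge_inf => //; exists (\sum_u f u * mu1 u - \sum_v f v * mu2 v).
rewrite (dual _ cpi); apply: ler_sum => u _; apply: ler_sum => v _.
have [->|pi_neq0] := eqVneq (pi u v) 0; first by rewrite !mulr0.
case: cpi => /(_ u v)/andP[pi_ge0 _] _ _.
by rewrite ler_wpM2r// f_tight.
Qed.

(** * The bipartite graph and its degrees *)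

Lemma sum_itv (p a b : nat) : (b <= p)%N ->
  (\sum_(i < p) (a <= i < b))%N = (b - a)%N.
Proof.
(* Induction on [p] does not preserve [b <= p], hence the truncation [minn b p]. *)
move=> bp; suff -> : (\sum_(i < p) (a <= i < b))%N = (minn b p - a)%N by lia.
elim: p {bp} => [|p IHp]; first by rewrite big_ord0; lia.
by rewrite big_ord_recr /= IHp; case: (boolP (a <= p < b)%N); lia.
Qed.

Section HallGraph.
Variables m n d k : nat.
Hypotheses (k_gt0 : (0 < k)%N) (lt_kd : (k < d)%N).
Hypotheses (le_dm : (d <= m)%N) (le_dn : (d <= n)%N).

(* With [x = X_0] and [y = Y_0], the neighbours of [x] are [y], [A = Y[1, k]] and
   [D = Y]k, d[], and those of [y] are [x], [B = X[1, k[] and [C = X[k, d[]. *)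
Definition hall_gap (i j : nat) : bool :=
  [|| (i == 0%N) && (d <= j)%N, (j == 0%N) && (d <= i)%N
    | (1 <= j < k.+1)%N && (k <= i < d)%N].

Definition hall_adj (u v : 'I_m + 'I_n) : bool :=
  match u, v with
  | inl i, inr j | inr j, inl i => ~~ hall_gap i j
  | _, _ => false
  end.

Lemma hall_adj_sym : symmetric hall_adj.
Proof. by case=> [i|j] []. Qed.

Lemma hall_adj_irr : irreflexive hall_adj.
Proof. by case. Qed.

Definition hall_graph : sgraph := SGraph hall_adj_sym hall_adj_irr.

Definition hallX (i : 'I_m) : hall_graph := inl i.
Definition hallY (j : 'I_n) : hall_graph := inr j.

Lemma hall_deg_sum (u : hall_graph) : deg u =
  (\sum_(i < m) adj u (hallX i) + \sum_(j < n) adj u (hallY j))%N.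
Proof.
rewrite /deg -sum1_card big_mkcond /= big_sumType /=.
by congr (_ + _)%N; apply: eq_bigr => i _;
  rewrite inE /hallX /hallY /=; case: hall_adj.
Qed.

(** Apart from [x], a vertex of [B] misses nothing, one of [C] misses [A], and the others miss only
    [y]. *)
Lemma hall_degX (i : 'I_m) : deg (hallX i) =
  if i == 0%N :> nat then d else if (i < k)%N then n
  else if (i < d)%N then (n - k)%N else n.-1.
Proof.
rewrite hall_deg_sum /= big1// add0n /hall_gap.
case: ifP => [/eqP i0|i0].
  rewrite -[RHS]subn0 -(@sum_itv n 0 d)//; apply: eq_bigr => j _.
  by congr nat_of_bool; lia.
case: ifP => [ik|ik].
  rewrite -[RHS]subn0 -(@sum_itv n 0 n)//; apply: eq_bigr => j _.
  by congr nat_of_bool; have := ltn_ord j; lia.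
case: ifP => [id|id].
  have -> : (n - k = (1 - 0) + (n - k.+1))%N by lia.
  rewrite -(@sum_itv n 0 1) -1?(@sum_itv n k.+1 n)//; last by lia.
  rewrite -big_split; apply: eq_bigr => j _ /=.
  by have := ltn_ord j; lia.
rewrite -subn1 -(@sum_itv n 1 n)//; apply: eq_bigr => j _.
by congr nat_of_bool; have := ltn_ord j; lia.
Qed.

(** Apart from [y], a vertex of [A] misses [C], one of [D] misses nothing, and the others miss only
    [x]. *)
Lemma hall_degY (j : 'I_n) : deg (hallY j) =
  if j == 0%N :> nat then d else if (j <= k)%N then (m - (d - k))%N
  else if (j < d)%N then m else m.-1.
Proof.
rewrite hall_deg_sum /= addnC big1// add0n /hall_gap.
case: ifP => [/eqP j0|j0].
  rewrite -[RHS]subn0 -(@sum_itv m 0 d)//; apply: eq_bigr => i _.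
  by congr nat_of_bool; lia.
case: ifP => [jk|jk].
  have -> : (m - (d - k) = (k - 0) + (m - d))%N by lia.
  rewrite -(@sum_itv m 0 k) -1?(@sum_itv m d m)//; last by lia.
  rewrite -big_split; apply: eq_bigr => i _ /=.
  by have := ltn_ord i; lia.
case: ifP => [jd|jd].
  rewrite -[RHS]subn0 -(@sum_itv m 0 m)//; apply: eq_bigr => i _.
  by congr nat_of_bool; have := ltn_ord i; lia.
rewrite -subn1 -(@sum_itv m 1 m)//; apply: eq_bigr => i _.
by congr nat_of_bool; have := ltn_ord i; lia.
Qed.

Lemma hall_bipartition :
  bipartition (hallX @: [set: 'I_m])%SET (hallY @: [set: 'I_n])%SET.
Proof.
split.
- apply/setP => -[i|j]; rewrite !inE; apply/orP; [left|right];
  by apply/imsetP; eexists; rewrite ?inE.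
- by apply/pred0P => u /=; apply/negP => /andP[/imsetP[i _ ->] /imsetP[j _]].
- by move=> _ _ /imsetP[i _ ->] /imsetP[i' _ ->].
- by move=> _ _ /imsetP[j _ ->] /imsetP[j' _ ->].
Qed.

(** * The potential, the transport plan and their optimality *)

Variable R : realType.

Definition itv (a b i : nat) : R := (a <= i < b)%:R.

Lemma sumr_itv (p a b : nat) : (b <= p)%N ->
  \sum_(i < p) itv a b i = (b - a)%:R.
Proof. by move=> bp; rewrite -(sum_itv a bp) natr_sum. Qed.

Lemma itv_cat (a b c i : nat) : (a <= b <= c)%N ->
  itv a c i = itv a b i + itv b c i.
Proof. by move=> abc; rewrite /itv -natrD; congr _%:R; lia. Qed.

(** Across every edge the values differ by exactly 1; only the non-adjacent pairs from [A] (value 2)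
    to [C] (value -1) differ by 3. *)
Definition hall_potential (u : hall_graph) : R :=
  match u with
  | inl i => 1 - 2 * itv k d i
  | inr j => 2 * itv 1 k.+1 j
  end.

Lemma hall_potential_lipschitz (u v : hall_graph) :
  hall_potential u - hall_potential v <= (dist u v)%:R.
Proof.
apply: lipschitz_dist => {u v} u v.
  case: u v => [i|j] [i'|j'] //=; rewrite /hall_gap /itv.
    by case: (k <= i < d)%N; case: (1 <= j' < _)%N;
      rewrite ?andbT ?orbT ?andbF ?orbF //= => _; lra.
  by case: (k <= i' < d)%N; case: (1 <= j < _)%N;
    rewrite ?andbT ?orbT ?andbF ?orbF //= => _; lra.
(* The potential takes values in [-1, 2], so three vertices suffice for the global bound. *)
have : 3 <= #|hall_graph|%:R :> R.
  by rewrite ler_nat card_sum !card_ord; lia.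
case: u v => [i|j] [i'|j'] /=; rewrite /itv;
  do 2 case: (_ <= _ < _)%N => /=; lra.
Qed.

(* In units of [c]: [k - 1] units go uniformly from [A] to [B], [d - 1 - k] from
   [D] to [C], and the one unit left over from [A] to [C]. *)
Definition hall_plan (a : R) (u v : hall_graph) : R :=
  let c := (1 - a) / d%:R in
  match u, v with
  | inl i, inl i' => c * itv 0 1 i * itv 0 1 i'
  | inl i, inr j => (a - c) * itv 0 1 i * itv 0 1 j
  | inr j, inr j' => c * itv 0 1 j * itv 0 1 j'
  | inr j, inl i =>
      c * (itv 1 k.+1 j / k%:R * itv 1 k i
           + itv 1 k.+1 j / (k%:R * (d%:R - k%:R)) * itv k d i
           + itv k.+1 d j / (d%:R - k%:R) * itv k d i)
  end.

Let d_gt0 : (0 < d)%N := leq_trans k_gt0 (ltnW lt_kd).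
Let x : hall_graph := hallX (Ordinal (leq_trans d_gt0 le_dm)).
Let y : hall_graph := hallY (Ordinal (leq_trans d_gt0 le_dn)).

Lemma hall_adj_xy : adj x y.
Proof. by rewrite /= /hall_gap /=; lia. Qed.

Lemma hall_lazy_x (a : R) (u : hall_graph) : lazy_measure a x u =
  match u with
  | inl i => a * itv 0 1 i
  | inr j => (1 - a) / d%:R * itv 0 d j
  end.
Proof.
rewrite /lazy_measure hall_degX eqxx; case: u => [i|j] /=.
  have -> : ((inl i : hall_graph) == x) = (i < 1)%N by rewrite ltnS leqn0.
  by rewrite /itv /=; case: ifP => _; rewrite ?mulr1 ?mulr0.
have -> : ~~ hall_gap 0 j = (j < d)%N by rewrite /hall_gap; lia.
by rewrite /itv /=; case: ifP => _; rewrite ?mulr1 ?mulr0.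
Qed.

Lemma hall_lazy_y (a : R) (u : hall_graph) : lazy_measure a y u =
  match u with
  | inl i => (1 - a) / d%:R * itv 0 d i
  | inr j => a * itv 0 1 j
  end.
Proof.
rewrite /lazy_measure hall_degY eqxx; case: u => [i|j] /=; last first.
  have -> : ((inr j : hall_graph) == y) = (j < 1)%N by rewrite ltnS leqn0.
  by rewrite /itv /=; case: ifP => _; rewrite ?mulr1 ?mulr0.
have -> : ~~ hall_gap i 0 = (i < d)%N by rewrite /hall_gap; lia.
by rewrite /itv /=; case: ifP => _; rewrite ?mulr1 ?mulr0.
Qed.

Lemma sumr_mul_itv (p a b : nat) (z : R) : (b <= p)%N ->
  \sum_(i < p) z * itv a b i = z * (b - a)%:R.
Proof. by move=> bp; rewrite -mulr_sumr sumr_itv. Qed.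

Lemma sumr_itv_mul (p a b : nat) (z t : R) : (b <= p)%N ->
  \sum_(i < p) z * itv a b i * t = z * (b - a)%:R * t.
Proof. by move=> bp; rewrite -mulr_suml sumr_mul_itv. Qed.

(** In units of [c], a vertex of [A] sends (k - 1)/k to [B] and 1/k to [C]; a vertex of [D] sends 1
    to [C]. *)
Lemma hall_plan_row (a : R) (u : hall_graph) :
  \sum_v hall_plan a u v = lazy_measure a x u.
Proof.
have d_gt0R : 0 < d%:R :> R by rewrite ltr0n.
have k_gt0R : 0 < k%:R :> R by rewrite ltr0n.
have lt_kdR : k%:R < d%:R :> R by rewrite ltr_nat.
rewrite hall_lazy_x big_sumType /=; case: u => [i|j] /=.
  rewrite !sumr_mul_itv; [|lia..].
  by rewrite subn0; ring.
rewrite -mulr_sumr !big_split /= !sumr_mul_itv; [|lia..].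
rewrite (@itv_cat 0 1 d) ?(@itv_cat 1 k.+1 d); [|lia..].
rewrite subn0 !natrB; [|lia..].
by field; apply/and3P; split; lra.
Qed.

(** In units of [c], a vertex of [C] receives 1/(d - k) from [A] and (d - 1 - k)/(d - k) from
    [D]. *)
Lemma hall_plan_col (a : R) (v : hall_graph) :
  \sum_u hall_plan a u v = lazy_measure a y v.
Proof.
have d_gt0R : 0 < d%:R :> R by rewrite ltr0n.
have k_gt0R : 0 < k%:R :> R by rewrite ltr0n.
have lt_kdR : k%:R < d%:R :> R by rewrite ltr_nat.
rewrite hall_lazy_y big_sumType /=; case: v => [i|j] /=; last first.
  rewrite !sumr_itv_mul; [|lia..].
  by rewrite subn0; ring.
rewrite -mulr_sumr !big_split /= sumr_itv_mul; last by lia.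
rewrite -!mulr_suml !sumr_itv; [|lia..].
rewrite (@itv_cat 0 1 d) ?(@itv_cat 1 k d); [|lia..].
rewrite subn0 !natrB -?natr1; [|lia..].
by field; apply/and3P; split; lra.
Qed.

Lemma itv_ge0 (a b i : nat) : 0 <= itv a b i.
Proof. exact: ler0n. Qed.

Lemma itv_le1 (a b i : nat) : itv a b i <= 1.
Proof. by rewrite /itv; case: (_ <= _ < _)%N. Qed.

Lemma hall_coupling (a : R) : 1 / 2 <= a <= 1 ->
  coupling (lazy_measure a x) (lazy_measure a y) (hall_plan a).
Proof.
move=> /andP[a_ge a_le].
have d_ge1 : 1 <= d%:R :> R by rewrite ler1n.
have c_ge0 : 0 <= (1 - a) / d%:R by rewrite divr_ge0//; lra.
have c_le : (1 - a) / d%:R <= 1 - a by rewrite ler_pdivrMr; nra.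
have dk_ge0 : 0 <= d%:R - k%:R :> R by rewrite subr_ge0 ler_nat ltnW.
have plan_ge0 u v : 0 <= hall_plan a u v.
  (* This mass goes from [x] to [y]; its sign is where [1 / 2 <= a] enters. *)
  have : 0 <= a - (1 - a) / d%:R by lra.
  move: c_ge0 dk_ge0; rewrite /hall_plan.
  move: (_ / _) (d%:R - _) => c e; move: (a - c) => c' ? ? ?.
  case: u v => [i|j] [i'|j'];
    rewrite ?(mulr_ge0, addr_ge0, itv_ge0, invr_ge0, ler0n)//.
split; [move=> u v | exact: hall_plan_row | exact: hall_plan_col].
(* A non-negative entry is at most its row sum, which is at most 1. *)
rewrite plan_ge0 /=; apply: (@le_trans _ _ (lazy_measure a x u)).
  by rewrite -hall_plan_row (bigD1 v)//= lerDl sumr_ge0.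
rewrite hall_lazy_x; case: u => [i|j].
  by have := itv_ge0 0 1 i; have := itv_le1 0 1 i; nra.
by have := itv_ge0 0 d j; have := itv_le1 0 d j; nra.
Qed.

(** Mass stays put, crosses an edge along which the potential drops by 1, or goes from [A] to
    [C]. *)
Lemma hall_plan_tight (a : R) (u v : hall_graph) : hall_plan a u v != 0 ->
  (dist u v)%:R <= hall_potential u - hall_potential v.
Proof.
have dist_le (p : seq hall_graph) :
      path (@adj hall_graph) u p -> last u p = v ->
    (dist u v)%:R <= (size p)%:R :> R.
  by move=> up vp; rewrite ler_nat dist_le_walk.
case: u v dist_le => [i|j] [i'|j'] /= dist_le.
- rewrite !mulf_eq0 !negb_or !pnatr_eq0 !eqb0 !negbK => /andP[/andP[_ i0] i0'].
  have ii' : i = i' by apply: val_inj => /=; lia.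
  by apply: (le_trans (dist_le [::] isT _)); rewrite ii' ?subrr.
- rewrite !mulf_eq0 !negb_or !pnatr_eq0 !eqb0 !negbK => /andP[/andP[_ i0] j0].
  apply: (le_trans (dist_le [:: inr j'] _ _)) => //=.
    by rewrite /hall_gap; lia.
  rewrite /itv.
  have -> : (k <= i < d)%N = false by lia.
  have -> : (1 <= j' < k.+1)%N = false by lia.
  by rewrite /=; lra.
- rewrite /itv; have [jA|jA] := boolP (1 <= j < k.+1)%N.
    have [iC _|iC] := boolP (k <= i' < d)%N.
      (* The detour through [x] and [y] has length 3, equal to the drop 2 - (-1). *)
      apply: (le_trans (dist_le [:: x; y; inl i'] _ _)) => //=; last by lra.
      by rewrite /hall_gap /=; lia.
    have [iB _|iB] := boolP (1 <= i' < k)%N; last first.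
      by rewrite !(mulr0, addr0) eqxx.
    apply: (le_trans (dist_le [:: inl i'] _ _)) => //=; last by lra.
    by rewrite /hall_gap /=; lia.
  have [iC|iC] := boolP (k <= i' < d)%N; last first.
    by rewrite !(mulr0, mul0r, addr0) eqxx.
  have [jD _|jD] := boolP (k.+1 <= j < d)%N; last first.
    by rewrite !(mulr0, mul0r, addr0) eqxx.
  apply: (le_trans (dist_le [:: inl i'] _ _)) => //=; last by lra.
  by rewrite /hall_gap /=; lia.
- rewrite !mulf_eq0 !negb_or !pnatr_eq0 !eqb0 !negbK => /andP[/andP[_ j0] j0'].
  have jj' : j = j' by apply: val_inj => /=; lia.
  by apply: (le_trans (dist_le [::] isT _)); rewrite jj' ?subrr.
Qed.

(** With c = (1 - a)/d, the contributions give a + 2ck - (ck - c(d - k)) = a + cd = 1. *)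
Lemma hall_dual_value (a : R) :
  \sum_u hall_potential u * lazy_measure a x u
  - \sum_v hall_potential v * lazy_measure a y v = 1.
Proof.
have d_gt0R : 0 < d%:R :> R by rewrite ltr0n.
under eq_bigr do rewrite hall_lazy_x.
under [X in _ - X]eq_bigr do rewrite hall_lazy_y.
rewrite !big_sumType /=; set c := (1 - a) / d%:R.
have -> : \sum_(i < m) (1 - 2 * itv k d i) * (a * itv 0 1 i) = a.
  rewrite -[RHS]mulr1 -(@sumr_mul_itv m 0 1); last by lia.
  apply: eq_bigr => i _; rewrite /itv.
  case: (boolP (0 <= i < 1)%N) => [i0|]; last by rewrite !mulr0.
  have -> : (k <= i < d)%N = false by lia.
  by rewrite /=; ring.
have -> : \sum_(j < n) 2 * itv 1 k.+1 j * (c * itv 0 d j) = 2 * c * k%:R.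
  rewrite -[X in _ * X%:R]subn0 -subSS -(@sumr_mul_itv n 1 k.+1); last by lia.
  apply: eq_bigr => j _; rewrite /itv.
  case: (boolP (1 <= j < k.+1)%N) => [jA|_]; last by rewrite /=; ring.
  have -> : (0 <= j < d)%N by lia.
  by rewrite /=; ring.
(* The range [0, k) is [x] together with [B], so [k] vertices have potential 1. *)
have -> : \sum_(i < m) (1 - 2 * itv k d i) * (c * itv 0 d i)
    = c * k%:R - c * (d - k)%:R.
  rewrite -[X in c * X%:R - _]subn0 -mulNr -!(@sumr_mul_itv m) -?big_split;
    [|lia..].
  apply: eq_bigr => i _; rewrite (@itv_cat 0 k d) /itv; last by lia.
  case: (boolP (k <= i < d)%N) => [iC|_]; last by rewrite /=; ring.
  have -> : (0 <= i < k)%N = false by lia.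
  by rewrite /=; ring.
have -> : \sum_(j < n) 2 * itv 1 k.+1 j * (a * itv 0 1 j) = 0.
  apply: big1 => j _; rewrite /itv.
  case: (boolP (0 <= j < 1)%N) => [j0|]; last by rewrite !mulr0.
  have -> : (1 <= j < k.+1)%N = false by lia.
  by rewrite /=; ring.
rewrite /c natrB; last exact: ltnW.
by field; rewrite gt_eqF.
Qed.

(** * Curvature of the edge [xy] *)

Lemma hall_wasserstein (a : R) : 1 / 2 <= a <= 1 ->
  wasserstein (lazy_measure a x) (lazy_measure a y) = 1.
Proof.
move=> a_itv; rewrite -(hall_dual_value a).
apply: wasserstein_certificate (hall_coupling a_itv) hall_potential_lipschitz _.
exact: hall_plan_tight.
Qed.

Lemma hall_kappa_quotient :
  \forall a \near (1 : R)^'-, kappa_quotient x y a = 0.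
Proof.
near=> a.
have a_ge : 1 / 2 <= a.
  by near: a; apply: nbhs_left_ge; lra.
have a_le : a <= 1 by near: a; exact: nbhs_left_le.
by rewrite /kappa_quotient /kappa hall_wasserstein ?a_ge// subrr mul0r.
Unshelve. all: by end_near. Qed.

Lemma hall_curvature :
  [/\ adj x y, cvg (kappa_quotient x y a @[a --> (1 : R)^'-])
    & kappa_LLY R x y = 0].
Proof.
have cvg0 : kappa_quotient x y a @[a --> (1 : R)^'-] --> (0 : R).
  by apply: cvg_near_cst; exact: hall_kappa_quotient.
split; first exact: hall_adj_xy.
  by apply/cvg_ex; exists 0.
exact: cvg_lim.
Qed.

End HallGraph.

(** * Choice of [d] and [k] for given [m] and [n] *)

Theorem theorem3p3 (R : realType) (m n : nat)
    (hn : (2 <= n)%N) (hmn : (n <= m)%N) :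
  exists (G0 : sgraph) (X Y : {set G0}),
    [/\ bipartition X Y, #|X| = m, #|Y| = n,
        min_degree G0 = (minn n ((m + n) %/ 3 + 1) - 1)%N
      & exists x y : G0,
          [/\ adj x y,
              cvg (kappa_quotient x y a @[a --> (1 : R)^'-])
            & kappa_LLY R x y <= 0]].
Proof.
set r := (_ - 1)%N.
(* Taking [d] at least 2 leaves room for [0 < k < d] when [r] is 1. *)
pose d := maxn r 2; pose k := minn (n - r) (d - 1).
have k_gt0 : (0 < k)%N by rewrite /k /d /r; lia.
have lt_kd : (k < d)%N by rewrite /k /d /r; lia.
have le_dm : (d <= m)%N by rewrite /d /r; lia.
have le_dn : (d <= n)%N by rewrite /d /r; lia.
exists (hall_graph m n d k), (@hallX m n d k @: [set: 'I_m])%SET.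
exists (@hallY m n d k @: [set: 'I_n])%SET.
split.
- exact: hall_bipartition.
- by rewrite card_imset ?cardsT ?card_ord//; move=> ? ? [].
- by rewrite card_imset ?cardsT ?card_ord//; move=> ? ? [].
- have [z degz] : exists z : hall_graph m n d k, deg z = r.
    have [r2|r1] := leqP 2 r.
      (* Here [d = r], so [x] itself has degree [r]. *)
      have m_gt0 : (0 < m)%N by lia.
      exists (@hallX m n d k (Ordinal m_gt0)).
      by rewrite hall_degX//= /d; lia.
    (* Now [r = 1] forces [n = d = 2] and [k = 1]; the vertex of index 1 lies in [C] and has degree
       [n - k = 1]. *)
    have m_gt1 : (1 < m)%N by lia.
    exists (@hallX m n d k (Ordinal m_gt1)).
    rewrite hall_degX//=.
    have -> : (1 < k)%N = false by rewrite /k /d; lia.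
    have -> : (1 < d)%N by rewrite /d; lia.
    by move: r1; rewrite /k /d /r; lia.
  apply: (@min_degree_eq _ _ z) => // -[i|j].
    rewrite [deg _](hall_degX k_gt0)//.
    by do ![case: ifP => _]; rewrite /k /d /r; lia.
  (* On [A], the bound for [d = r] and [k = n - r] reads [3 r <= m + n]; for [k = d - 1] it reads
     [r <= m - 1]. *)
  rewrite [deg _](hall_degY k_gt0)//.
  by do ![case: ifP => _]; rewrite /k /d /r; lia.
have [xy kcvg k0] := hall_curvature k_gt0 lt_kd le_dm le_dn R.
by eexists; eexists; split; [exact: xy | exact: kcvg | rewrite k0].
Qed.
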